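(* Fix $\varepsilon\in(0,1/2)$. There is a constant $B(\varepsilon)\in(0,\infty)$ such that for every $N$ and every $\eta>0$ the following holds. If $V_N=\mathbb Z/2N\mathbb Z$ (with $2N\ge3$) and $(K_i)_{i\ge1}$ is any sequence with $K_i\in\mathcal Q_{\mathrm{lazy}}(\varepsilon)$ for all $i$, or if $V_N=\mathbb Z/(2N+1)\mathbb Z$ and $(K_i)_{i\ge1}$ is any sequence with $K_i\in\mathcal Q(\varepsilon)$ for all $i$, then for all $n\ge B(\varepsilon)N^2(1+\log_+(1/\eta))$, \[\max_{x,y,z\in V_N}\Bigl|\frac{K_{0,n}(x,z)}{K_{0,n}(y,z)}-1\Bigr|\le\eta.\] In particular, the total variation $\eta$-merging time of $\mathcal Q_{\mathrm{lazy}}(\varepsilon)$ on $\mathbb Z/2N\mathbb Z$ (resp. of $\mathcal Q(\varepsilon)$ on $\mathbb Z/(2N+1)\mathbb Z$) is at most $B(\varepsilon)N^2(1+\log_+(1/\eta))$.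
   Context: $Q$ is the simple random walk kernel on $\mathbb Z/p\mathbb Z$: $Q(x,y)=1/2$ if $y=x\pm1$, $0$ otherwise. For $\delta\in(-1/2,1/2)$, $Q_\delta=Q+\Delta_\delta$ with $\Delta_\delta(0,1)=\delta$, $\Delta_\delta(0,-1)=-\delta$, $\Delta_\delta(x,y)=0$ otherwise. $\mathcal Q(\varepsilon)=\{Q_\delta:\delta\in[-\varepsilon,\varepsilon]\}$ and $\mathcal Q_{\mathrm{lazy}}(\varepsilon)=\{\frac12(I+K):K\in\mathcal Q(\varepsilon)\}$. $K_{0,n}=K_1K_2\cdots K_n$ (matrix product). The family $\mathcal Q$ has total variation $\eta$-merging time at most $T$ if for every sequence $(K_i)$ with $K_i\in\mathcal Q$ and every $t>T$, $\max_{x,y}\|K_{0,t}(x,\cdot)-K_{0,t}(y,\cdot)\|_{\mathrm{TV}}\le\eta$, where $\|\mu-\nu\|_{\mathrm{TV}}=\sup_A(\mu(A)-\nu(A))$. Conventions $0/0=1$, $a/0=\infty$ for $a>0$. $\log_+t=\max(\log t,0)$. *)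

(* Defs.v *)
From HB Require Import structures.
From mathcomp Require Import all_boot all_order all_algebra.
From mathcomp Require Import all_classical all_reals.
From mathcomp Require Import ereal exp.
Set Implicit Arguments. Unset Strict Implicit. Unset Printing Implicit Defensive.
Import Order.TTheory GRing.Theory Num.Theory.
Local Open Scope ring_scope.

Section Defs.
Variable R : realType.

Definition Qdelta (p : nat) (d : R) : 'M[R]_p :=
  \matrix_(x < p, y < p)
    ((if (y : nat) == (x.+1 %% p)%N then 1/2 else 0)
   + (if (y : nat) == ((x + p.-1) %% p)%N then 1/2 else 0)
   + (if ((x : nat) == 0%N) && ((y : nat) == (1 %% p)%N) then d else 0)
   - (if ((x : nat) == 0%N) && ((y : nat) == (p.-1 %% p)%N) then d else 0)).

Definition Qfam (p : nat) (eps : R) (K : 'M[R]_p) : Prop :=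
  exists d : R, -eps <= d <= eps /\ K = Qdelta p d.

Definition Qlazy (p : nat) (eps : R) (K : 'M[R]_p) : Prop :=
  exists K' : 'M[R]_p, Qfam eps K' /\ K = (1/2) *: (1%:M + K').

Fixpoint Kprod (p : nat) (K : nat -> 'M[R]_p) (n : nat) : 'M[R]_p :=
  match n with
  | 0 => 1%:M
  | n'.+1 => Kprod K n' *m K n'.+1
  end.

(* |a/b - 1| with conventions 0/0 = 1 and a/0 = +oo for a > 0 *)
Definition ratio_dev (a b : R) : \bar R :=
  if b == 0 then (if a == 0 then 0%E else +oo%E)
  else (`|a / b - 1|)%:E.

Definition logp (t : R) : R := Num.max (ln t) 0.

Definition tv (p : nat) (mu nu : 'I_p -> R) : R :=
  \big[Num.max/0]_(A : {set 'I_p}) (\sum_(z in A) (mu z - nu z)).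

Definition merging_time_le (p : nat) (F : 'M[R]_p -> Prop) (eta T : R) : Prop :=
  forall K : nat -> 'M[R]_p, (forall i, (0 < i)%N -> F (K i)) ->
  forall t : nat, T < t%:R ->
  forall x y : 'I_p, tv (fun z => Kprod K t x z) (fun z => Kprod K t y z) <= eta.

End Defs.

(* Main.v *)
(* Write K_i = A + G_i with A the unperturbed kernel. The reflection x -> -x
   commutes with A, fixes the rows and changes the sign of the columns of the
   perturbations, so G_i A^k G_j = 0: every product containing two perturbations
   vanishes and K_{0,n} is affine in (G_i). Rescaling the G_i by 1/(2 eps) still
   gives nonnegative matrices, whence
     (1 - 2 eps) A^n <= K_{0,n} <= (1 + 2 eps) A^n   entrywise.
   For A, a lazy walk with steps +-a (a = 1 for the lazy walk; the square of the
   simple walk is one with a = 2, invertible modulo an odd number), let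
   f_k = A^k(., z). The Dirichlet energy of f_k is nonincreasing and bounded by
   4 (|f_k|^2 - |f_{k+1}|^2), and |f_n|^2 = f_{2n}(z), so the energy of f_{2n} is
   at most 4 max f_{2n} / n. As max f_{2n} >= 1/p, for n >= 16 p^2 Cauchy-Schwarz
   along the cycle bounds the oscillation of f_{2n} by half its maximum. Hence
   c K(x, z) <= K(y, z) for every block K of order N^2 factors, and each such
   block contracts the relative oscillation of z-columns by 1 - c. *)
Require Import Defs.
From HB Require Import structures.
From mathcomp Require Import all_boot all_order all_algebra.
From mathcomp Require Import all_classical all_reals.
From mathcomp Require Import ereal exp.
From mathcomp Require Import sequences zify ring lra.
Import Order.TTheory GRing.Theory Num.Theory.
Set Implicit Arguments. Unset Strict Implicit.
Local Open Scope ring_scope.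

(** * Products of perturbed kernels *)

Section Products.
Context {R : realType} {p : nat}.
Lemma Kprod_eq (K L : nat -> 'M[R]_p) n :
  (forall i, (0 < i)%N -> K i = L i) -> Kprod K n = Kprod L n.
Proof. by move=> KL; elim: n => //= n ->; rewrite KL. Qed.

Lemma Kprod_add (K : nat -> 'M[R]_p) m n :
  Kprod K (m + n) = Kprod K m *m Kprod (fun i => K (m + i)%N) n.
Proof.
elim: n => [|n IHn] /=; first by rewrite addn0 mulmx1.
by rewrite addnS /= IHn mulmxA.
Qed.

Lemma mxscaleAl (a : R) (A B : 'M[R]_p) : (a *: A) * B = a *: (A * B).
Proof. by rewrite -mulmxE -scalemxAl. Qed.

Lemma mxscaleAr (a : R) (A B : 'M[R]_p) : A * (a *: B) = a *: (A * B).
Proof. by rewrite -mulmxE -scalemxAr. Qed.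

(** The expansion of the product has no term of degree two or more in [G], so it is affine in [t];
    the values at [t = 0] and [t = 1] fix its coefficients. *)
Lemma Kprod_perturb (A : 'M[R]_p) (G : nat -> 'M[R]_p) (t : R) n :
  (forall i j k, (0 < i)%N -> (0 < j)%N -> G i * A ^+ k * G j = 0) ->
  Kprod (fun i => A + t *: G i) n
  = (1 - t) *: A ^+ n + t *: Kprod (fun i => A + G i) n.
Proof.
move=> GAG.
(* In front of [A ^+ k * G j] every perturbed factor acts as [A], its own [G i] being
   annihilated. *)
have absorb s m : forall j k, (0 < j)%N ->
    Kprod (fun i => A + s *: G i) m * (A ^+ k * G j) = A ^+ (m + k) * G j.
  elim: m => [|m IHm] j k j0 /=; first by rewrite mul1r.
  rewrite mulmxE -mulrA mulrDl mxscaleAl (mulrA (G _)) GAG // scaler0 addr0.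
  by rewrite (mulrA A) -exprS IHm // addSnnS.
elim: n => [|n IHn] /=; first by rewrite expr0 -scalerDl subrK scale1r.
have abs1 s := absorb s n n.+1 0%N isT.
move: (abs1 t) (abs1 1); rewrite expr0 mul1r addn0 => abst.
rewrite (@Kprod_eq (fun i => A + 1 *: G i) (fun i => A + G i)); last first.
  by move=> i _; rewrite scale1r.
move=> abs1'; rewrite !mulmxE !mulrDr mxscaleAr abst -abs1' IHn mulrDl.
by rewrite !mxscaleAl -exprSr scalerDr addrA.
Qed.

Lemma Kprod_ge0 (K : nat -> 'M[R]_p) n :
  (forall i, (0 < i)%N -> forall x y, 0 <= K i x y) ->
  forall x y, 0 <= Kprod K n x y.
Proof.
move=> K0; elim: n => [|n IHn] x y /=; first by rewrite mxE ler0n.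
by rewrite mxE sumr_ge0 // => j _; rewrite mulr_ge0 ?K0.
Qed.

(** With [G i = (K i - A) / t], both [A + G i] and [A - G i] are nonnegative. If [P] is the product
    of the [A + G i], that of the [A - G i] is [2 A^n - P]. Hence [0 <= P <= 2 A^n], while
    [Kprod K n = (1 - t) A^n + t P]. *)
Lemma Kprod_perturb_bounds (A : 'M[R]_p) (K : nat -> 'M[R]_p) (t : R) n :
  0 < t -> t < 1 ->
  (forall i j k, (0 < i)%N -> (0 < j)%N ->
     (K i - A) * A ^+ k * (K j - A) = 0) ->
  (forall i, (0 < i)%N -> forall x y, `|(K i - A) x y| <= t * A x y) ->
  forall x y, (1 - t) * (A ^+ n) x y <= Kprod K n x y <= (1 + t) * (A ^+ n) x y.
Proof.
move=> t0 t1 GAG GA x y.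
pose G i := t^-1 *: (K i - A).
have GG i j k : (0 < i)%N -> (0 < j)%N -> G i * A ^+ k * G j = 0.
  by move=> i0 j0; rewrite !mxscaleAl mxscaleAr GAG // !scaler0.
have GA' i : (0 < i)%N -> forall x y, `|G i x y| <= A x y.
  move=> i0 u v; rewrite mxE normrM gtr0_norm ?invr_gt0 // mulrC.
  by rewrite ler_pdivrMr // mulrC GA.
rewrite (@Kprod_eq K (fun i => A + t *: G i)); last first.
  by move=> i _; rewrite scalerA divff ?gt_eqF // scale1r addrC subrK.
rewrite Kprod_perturb // !mxE.
have /(congr1 (fun M : 'M_p => M x y)) := Kprod_perturb (-1) n GG.
rewrite !mxE.
have H1 : 0 <= Kprod (fun i => A + -1 *: G i) n x y.
  apply: Kprod_ge0 => i i0 u v; have := GA' i i0 u v.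
  by rewrite !mxE ler_norml => /andP[]; lra.
have H2 : 0 <= Kprod (fun i => A + G i) n x y.
  apply: Kprod_ge0 => i i0 u v; have := GA' i i0 u v.
  by rewrite !mxE ler_norml => /andP[]; lra.
by move=> E; rewrite {}E in H1; nra.
Qed.

(** * Stochastic matrices and the relative oscillation of columns *)

Definition stochastic (A : 'M[R]_p) :=
  (forall x y, 0 <= A x y) /\ (forall x, \sum_y A x y = 1).

Lemma stochastic1 : stochastic 1%:M.
Proof.
split=> [x y|x]; first by rewrite mxE ler0n.
rewrite (bigD1 x) //= mxE eqxx big1 ?addr0 // => y /negPf yx.
by rewrite mxE eq_sym yx.
Qed.

Lemma stochasticM A B : stochastic A -> stochastic B -> stochastic (A *m B).
Proof.
move=> [A0 A1] [B0 B1]; split=> [x y|x].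
  by rewrite mxE sumr_ge0 // => j _; rewrite mulr_ge0.
under eq_bigr do rewrite mxE.
rewrite exchange_big /= -(A1 x); apply: eq_bigr => j _.
by rewrite -mulr_sumr B1 mulr1.
Qed.

Lemma stochastic_Kprod (K : nat -> 'M[R]_p) n :
  (forall i, (0 < i)%N -> stochastic (K i)) -> stochastic (Kprod K n).
Proof.
move=> Ks; elim: n => [|n IHn] /=; first exact: stochastic1.
by apply: stochasticM => //; apply: Ks.
Qed.

(** That is, max minus min is at most [theta] times min. Being free of division, the condition still
    makes sense when [h] vanishes somewhere. *)
Definition osc_le (theta : R) (h : 'I_p -> R) :=
  (forall x, 0 <= h x) /\ (forall x y w, h x - h y <= theta * h w).

(** Rows of [B] sum to 1, so the minimum of [h] can be subtracted first. The remainder [g] lies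
    between 0 and [theta * h w0]; its averages differ by at most [1 - c] times that bound, and
    averaging does not lower the minimum. *)
Lemma osc_le_block (B : 'M[R]_p) (c theta : R) (h : 'I_p -> R) :
  stochastic B -> c <= 1 -> (forall x y z, c * B x z <= B y z) ->
  0 <= theta -> osc_le theta h ->
  osc_le ((1 - c) * theta) (fun x => \sum_z B x z * h z).
Proof.
move=> [B0 B1] c1 cB th0 [h0 osch]; split=> [x|x y w].
  by rewrite sumr_ge0 // => z _; rewrite mulr_ge0.
have [w0 _ w0min] := @arg_minP _ _ _ x xpredT h isT.
pose g z := h z - h w0.
have Bh u : \sum_z B u z * h z = \sum_z B u z * g z + h w0.
  rewrite -[in RHS](mul1r (h w0)) -(B1 u) mulr_suml -big_split /=.
  by apply: eq_bigr => z _; rewrite /g; ring.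
have g0 z : 0 <= g z by rewrite subr_ge0 w0min.
have cBg : c * (\sum_z B x z * g z) <= \sum_z B y z * g z.
  by rewrite mulr_sumr ler_sum // => z _; rewrite mulrA ler_wpM2r.
have Bgle u : \sum_z B u z * g z <= theta * h w0.
  rewrite -[leRHS]mul1r -(B1 u) mulr_suml ler_sum // => z _.
  by rewrite ler_wpM2l // osch.
have Bg0 : 0 <= \sum_z B w z * g z.
  by rewrite sumr_ge0 // => z _; rewrite mulr_ge0.
rewrite !Bh.
have k1 : (1 - c) * (\sum_z B x z * g z) <= (1 - c) * (theta * h w0).
  by rewrite ler_wpM2l // subr_ge0.
have k2 : 0 <= (1 - c) * theta * (\sum_z B w z * g z).
  by rewrite !mulr_ge0 // subr_ge0.
nra.
Qed.

Lemma osc_le_stochastic (B : 'M[R]_p) (theta : R) (h : 'I_p -> R) :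
  stochastic B -> 0 <= theta -> osc_le theta h ->
  osc_le theta (fun x => \sum_z B x z * h z).
Proof.
move=> Bs th0 hosc; have := @osc_le_block B 0 theta h Bs ler01.
rewrite subr0 mul1r; apply=> // x y z; rewrite mul0r; exact: Bs.1.
Qed.

(** The rightmost factors act on a column first: the last block gives the initial oscillation
    [1 / c], and [k] blocks peeled off the front contract it. The comparison is assumed for all
    sequences in [F] so that it applies after a shift. *)
Lemma osc_le_Kprod (F : 'M[R]_p -> Prop) (T : nat) (c : R) :
  0 < c -> c <= 1 -> (forall A, F A -> stochastic A) ->
  (forall K : nat -> 'M[R]_p, (forall i, (0 < i)%N -> F (K i)) ->
     forall x y z, c * Kprod K T x z <= Kprod K T y z) ->
  forall (K : nat -> 'M[R]_p), (forall i, (0 < i)%N -> F (K i)) ->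
  forall k n z, (k.+1 * T <= n)%N ->
  osc_le ((1 - c) ^+ k / c) (fun x => Kprod K n x z).
Proof.
move=> c0 c1 Fs FT K FK k; elim: k K FK => [|k IHk] K FK n z kTn.
  (* The leading [n - T] factors only average the column of the last block, which preserves its
     bound. *)
  rewrite mul1n in kTn; rewrite -(subnK kTn) Kprod_add.
  set L := (X in _ *m Kprod X _).
  have FL i : (0 < i)%N -> F (L i) by move=> i0; apply: FK; rewrite ltn_addl.
  have Ls i : (0 < i)%N -> stochastic (L i) by move=> i0; apply/Fs/FL.
  have Ks i : (0 < i)%N -> stochastic (K i) by move=> i0; apply/Fs/FK.
  have [L0 _] := stochastic_Kprod T Ls.
  have -> : (fun x => (Kprod K (n - T) *m Kprod L T) x z) =
      (fun x => \sum_w Kprod K (n - T) x w * Kprod L T w z).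
    by apply/funext => x; rewrite mxE.
  apply: osc_le_stochastic; first exact: stochastic_Kprod.
    by rewrite expr0 div1r invr_ge0 ltW.
  split=> // x y w; rewrite expr0 div1r mulrC ler_pdivlMr // mulrC.
  by apply: le_trans (FT _ FL x w z); rewrite ler_pM2l // gerBl.
have Tn : (T <= n)%N by apply: leq_trans kTn; rewrite leq_pmull.
rewrite -(subnKC Tn) Kprod_add.
set L := (X in _ *m Kprod X _).
have FL i : (0 < i)%N -> F (L i) by move=> i0; apply: FK; rewrite ltn_addl.
have -> : (fun x => (Kprod K T *m Kprod L (n - T)) x z) =
    (fun x => \sum_w Kprod K T x w * Kprod L (n - T) w z).
  by apply/funext => x; rewrite mxE.
rewrite exprS -mulrA; apply: osc_le_block => //.
- by apply: stochastic_Kprod => i i0; apply/Fs/FK.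
- exact: FT.
- by rewrite divr_ge0 ?(ltW c0) // exprn_ge0 // subr_ge0.
- by apply: IHk => //; rewrite leq_subRL // -mulSn.
Qed.
End Products.

(** Cauchy-Schwarz, from the nonnegativity of the sum of squared deviations from the mean. *)
Lemma sqr_sum_le (R : realFieldType) (I : finType) (g : I -> R) :
  (\sum_i g i) ^+ 2 <= #|I|%:R * \sum_i g i ^+ 2.
Proof.
have [I0|I0] := posnP #|I|.
  by rewrite I0 mul0r big1 ?expr0n // => i; have := fintype0 i.
have cI : 0 < #|I|%:R :> R by rewrite ltr0n.
set S := \sum_i g i; set n := #|I|%:R in cI *.
have : 0 <= \sum_i (g i - S / n) ^+ 2 by rewrite sumr_ge0 // => i _; rewrite sqr_ge0.
have -> : \sum_i (g i - S / n) ^+ 2 = \sum_i g i ^+ 2 - S ^+ 2 / n.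
  under eq_bigr do rewrite sqrrB.
  rewrite big_split /= sumrB sumr_const -[_ *+ #|_|]mulr_natl -/n.
  under [X in _ - X + _]eq_bigr do rewrite -mulr_natr mulrAC.
  rewrite -!mulr_suml -/S; field; exact: lt0r_neq0.
by rewrite subr_ge0 ler_pdivrMr // mulrC.
Qed.

(** * Lazy walks and Dirichlet energy on a cycle *)

Section Cycle.
Context {R : realFieldType} {q : nat}.
Local Notation V := 'I_q.+2.
Implicit Types (a b : V) (f : V -> R) (A : 'M[R]_q.+2).

(** The index type ['I_q.+2] carries the ring of integers modulo [q.+2], so [x + a] wraps around the
    cycle. *)
Definition shiftmx a : 'M[R]_q.+2 := \matrix_(x, y) (y == x + a)%:R.
Definition reflmx : 'M[R]_q.+2 := \matrix_(x, y) (y == - x)%:R.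

Lemma shiftmx_mulE a A x y : (shiftmx a *m A) x y = A (x + a) y.
Proof.
rewrite mxE (bigD1 (x + a)) //= mxE eqxx mul1r big1 ?addr0 // => w /negPf wx.
by rewrite mxE wx mul0r.
Qed.

Lemma reflmx_mulE A x y : (reflmx *m A) x y = A (- x) y.
Proof.
rewrite mxE (bigD1 (- x)) //= mxE eqxx mul1r big1 ?addr0 // => w /negPf wx.
by rewrite mxE wx mul0r.
Qed.

Lemma mul_reflmxE A x y : (A *m reflmx) x y = A x (- y).
Proof.
rewrite mxE (bigD1 (- y)) //= mxE opprK eqxx mulr1 big1 ?addr0 // => w /negPf wy.
by rewrite mxE -eqr_oppLR eq_sym wy mulr0.
Qed.

Lemma shiftmxM a b : shiftmx a *m shiftmx b = shiftmx (a + b).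
Proof. by apply/matrixP => x y; rewrite shiftmx_mulE !mxE addrA. Qed.

Lemma shiftmx0 : shiftmx 0 = 1%:M.
Proof. by apply/matrixP => x y; rewrite !mxE addr0 eq_sym. Qed.

Lemma tr_shiftmx a : (shiftmx a)^T = shiftmx (- a).
Proof. by apply/matrixP => x y; rewrite !mxE -subr_eq eq_sym. Qed.

Lemma reflmx_shiftmx a : reflmx *m shiftmx a = shiftmx (- a) *m reflmx.
Proof.
by apply/matrixP => x y; rewrite reflmx_mulE shiftmx_mulE !mxE opprB addrC.
Qed.

Lemma sum_shift a f : \sum_x f (x + a) = \sum_x f x.
Proof. by rewrite [RHS](reindex_inj (addIr a)). Qed.

Definition hop a f x := 1/2 * f x + 1/4 * (f (x + a) + f (x - a)).
Definition energy a f := \sum_x (f (x + a) - f x) ^+ 2.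

(** [hop a f x] is the mean of the midpoint values of [f] on the two edges at [x], so convexity of
    the square applies. *)
Lemma sqr_hop_le a f :
  \sum_x hop a f x ^+ 2 <= \sum_x f x ^+ 2 - 1/4 * energy a f.
Proof.
(* By the parallelogram identity [G x] is the squared midpoint value
   [((f x + f (x + a)) / 2) ^+ 2]. *)
pose G x := (f x ^+ 2 + f (x + a) ^+ 2) / 2 - 1/4 * (f (x + a) - f x) ^+ 2.
have -> : \sum_x f x ^+ 2 - 1/4 * energy a f = \sum_x G x.
  rewrite sumrB -mulr_sumr -mulr_suml big_split /=.
  by rewrite (sum_shift a (fun x => f x ^+ 2)) -/(energy a f); field.
have -> : \sum_x G x = \sum_x (G x + G (x - a)) / 2.
  by rewrite -mulr_suml [in RHS]big_split /= (sum_shift (- a) G); field.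
apply: ler_sum => x _; rewrite /G /hop subrK.
set u := f (x - a); set v := f x; set w := f (x + a).
by have := sqr_ge0 (w - u); nra.
Qed.

Lemma energy_ge0 a f : 0 <= energy a f.
Proof. by apply: sumr_ge0 => x _; apply: sqr_ge0. Qed.

(** [hop] commutes with taking increments and does not increase the sum of squares. *)
Lemma energy_hop_le a f : energy a (hop a f) <= energy a f.
Proof.
pose g x := f (x + a) - f x.
have -> : energy a (hop a f) = \sum_x hop a g x ^+ 2.
  by apply: eq_bigr => x _; rewrite /hop /g addrK subrK; ring.
apply: le_trans (sqr_hop_le a g) _.
by rewrite gerBl mulr_ge0 ?energy_ge0 // divr_ge0.
Qed.

(** An invertible step [a] reaches every vertex; increments along the path telescope, and
    Cauchy-Schwarz bounds their sum by the energy. *)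
Lemma sqr_osc_le a b f x y :
  b * a = 1 -> (f x - f y) ^+ 2 <= q.+2%:R * energy a f.
Proof.
move=> ba1; pose g w := f (w + a) - f w.
have path k : (k <= q.+2)%N ->
    `|f (y + a *+ k) - f y| <= \sum_(j < q.+2) `|g (y + a *+ j)|.
  move=> kq; apply: (@le_trans _ _ (\sum_(j < k) `|g (y + a *+ j)|)).
    elim: k {kq} => [|k IHk]; first by rewrite big_ord0 mulr0n addr0 subrr normr0.
    rewrite big_ord_recr /=; apply: le_trans (lerD IHk (lexx _)).
    rewrite /g mulrSr addrA.
    by apply: le_trans (ler_normD _ _); rewrite [X in _ <= `|X|]addrC subrKA.
  rewrite (big_ord_widen _ (fun j => `|g (y + a *+ j)|) kq)
    [leRHS](bigID (fun j : V => (j < k)%N)) /=.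
  by rewrite lerDl sumr_ge0.
have amul (j : V) : a *+ j = a * j by rewrite -[in RHS](natr_Zp j) mulr_natr.
have ab1 : a * b = 1 by rewrite mulrC.
(* From [y], exactly [b * (x - y)] steps of [a] lead to [x]. *)
have := path (b * (x - y) : V) (ltnW (ltn_ord _)).
rewrite amul mulrA ab1 mul1r (addrC y) subrK.
under eq_bigr do rewrite amul.
(* The [q.+2] steps start from distinct vertices, so the sum over steps is a sum over vertices. *)
have inj : injective (fun j : V => y + a * j).
  by move=> i j /addrI /(congr1 ( *%R b)); rewrite !mulrA ba1 !mul1r.
rewrite -(reindex_inj inj (P := xpredT) (F := fun w => `|g w|)) /= => fxy.
have -> : energy a f = \sum_w `|g w| ^+ 2.
  by apply: eq_bigr => w _; rewrite real_normK ?num_real.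
rewrite -[q.+2 in leRHS]card_ord; apply: le_trans (sqr_sum_le _).
by rewrite -real_normK ?num_real // lerXn2r ?nnegrE ?sumr_ge0 // => *.
Qed.

Definition lazymx a : 'M[R]_q.+2 :=
  (1/2) *: 1%:M + (1/4) *: (shiftmx a + shiftmx (- a)).

Lemma tr_lazymx a : (lazymx a)^T = lazymx a.
Proof.
rewrite /lazymx linearD /= !linearZ /= trmx1 linearD /= !tr_shiftmx opprK.
by rewrite [shiftmx (- a) + _]addrC.
Qed.

Lemma tr_lazymxX a n : (lazymx a ^+ n)^T = lazymx a ^+ n.
Proof.
elim: n => [|n IHn]; first by rewrite expr0 trmx1.
by rewrite exprS -mulmxE trmx_mul IHn tr_lazymx mulmxE -exprSr exprS.
Qed.

Lemma lazymx_hop a A z x : (lazymx a *m A) x z = hop a (A^~ z) x.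
Proof.
rewrite mulmxDl -!scalemxAl mul1mx mulmxDl.
rewrite /hop -(shiftmx_mulE a) -(shiftmx_mulE (- a)).
by move: (shiftmx a *m A) (shiftmx (- a) *m A) => B C; rewrite !mxE.
Qed.

(** The exponent is even because symmetry of the kernel identifies the squared norm at time [n] with
    a diagonal entry at time [n + n]. *)
Lemma lazymxX_harnack a b n z x y :
  b * a = 1 -> (16 * q.+2 ^ 2 <= n)%N ->
  1/2 * (lazymx a ^+ (n + n)) x z <= (lazymx a ^+ (n + n)) y z.
Proof.
move=> ba1 nq; pose f k x := (lazymx a ^+ k) x z.
have fS k : f k.+1 = hop a (f k).
  by apply/funext => w; rewrite /f exprS -mulmxE lazymx_hop.
have f0 k w : 0 <= f k w.
  elim: k w => [|k IHk] w; first by rewrite /f expr0 mxE ler0n.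
  by rewrite fS /hop addr_ge0 ?mulr_ge0 ?addr_ge0.
have fsum k : \sum_w f k w = 1.
  elim: k => [|k IHk].
    rewrite (bigD1 z) //= /f expr0 mxE eqxx big1 ?addr0 // => w /negPf wz.
    by rewrite mxE wz.
  rewrite fS big_split /= -!mulr_sumr big_split /= !sum_shift IHk; lra.
have fsqr k : \sum_w f k w ^+ 2 = f (k + k)%N z.
  rewrite /f exprD -mulmxE mxE; apply: eq_bigr => w _.
  by rewrite -[in X in X * _](tr_lazymxX a k) mxE expr2.
(* Each of the [l] steps costs a quarter of the current energy, which is at least the final
   energy. *)
have Edec k l : \sum_w f (k + l)%N w ^+ 2 + 1/4 * l%:R * energy a (f (k + l)%N)
    <= \sum_w f k w ^+ 2.
  elim: l => [|l IHl]; first by rewrite addn0 mulr0 mul0r addr0.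
  apply: le_trans IHl; rewrite addnS -[l.+1%:R]natr1.
  have := sqr_hop_le a (f (k + l)%N); have := energy_hop_le a (f (k + l)%N).
  rewrite -fS => E_le; have := ler_wpM2l (ler0n R l.+1) E_le; rewrite -[l.+1%:R]natr1.
  by lra.
have [M _ Mmax] := @arg_maxP _ _ _ z xpredT (f (n + n)%N) isT.
have M1 : 1 <= q.+2%:R * f (n + n)%N M.
  have <- : \sum_(w : V) f (n + n)%N M = q.+2%:R * f (n + n)%N M.
    by rewrite sumr_const card_ord mulr_natl.
  by rewrite -(fsum (n + n)%N); apply: ler_sum => w _; apply: Mmax.
set m := q.+2%:R in M1; have m0 : 0 < m by rewrite ltr0n.
have nm : 16 * m ^+ 2 <= n%:R by rewrite -natrX -natrM ler_nat.
have osc := sqr_osc_le (f (n + n)%N) M y ba1.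
have En : 1/4 * n%:R * energy a (f (n + n)%N) <= f (n + n)%N M.
  apply: le_trans (Mmax z isT); rewrite -fsqr; apply: le_trans (Edec n n).
  by rewrite lerDr sumr_ge0 // => w _; rewrite sqr_ge0.
rewrite -/(f _ x) -/(f _ y).
have fx : f (n + n)%N x <= f (n + n)%N M := Mmax x isT.
set F := f (n + n)%N in M1 osc En fx *.
set E := energy _ _ in osc En; have E0 : 0 <= E := energy_ge0 _ _.
(* The squared oscillation is at most [m * E]. The size of [n] gives [4 m^2 E <= F M], and
   [m * F M >= 1] improves this to [m * E <= (F M / 2)^2]. *)
have half : (F M - F y) ^+ 2 <= (F M / 2) ^+ 2.
  apply: le_trans osc _; rewrite -/m.
  have FM0 : 0 <= F M := f0 _ _.
  have h1 : 4 * m ^+ 2 * E <= F M.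
    by apply: le_trans En; rewrite ler_wpM2r //; lra.
  rewrite -(ler_pM2l m0); have h2 : F M <= F M * (m * F M) by rewrite ler_peMr.
  nra.
have : F M - F y <= F M / 2.
  apply: le_trans (ler_norm _) _; rewrite -[leRHS]ger0_norm ?divr_ge0 ?f0 //.
  by rewrite -ler_sqr ?nnegrE // !real_normK ?num_real.
by lra.
Qed.
End Cycle.

(** * Both families as perturbations of reflection-symmetric walks *)

Section Walk.
Context {R : realType} {q : nat}.
Local Notation V := 'I_q.+2.
Implicit Types (d eps : R) (a b : V) (A : 'M[R]_q.+2).

Definition walkmx : 'M[R]_q.+2 := (1/2) *: (shiftmx 1 + shiftmx (- 1)).
Definition jumpmx : 'M[R]_q.+2 :=
  \matrix_(x, y) ((x == 0)%:R * ((y == 1)%:R - (y == - 1)%:R)).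

Lemma QdeltaE d : Qdelta q.+2 d = walkmx + d *: jumpmx.
Proof.
apply/matrixP => x y; rewrite !mxE.
have succE : ((y : nat) == x.+1 %% q.+2)%N = (y == x + 1).
  by rewrite -val_eqE /= modnDmr addn1.
have predE : ((y : nat) == (x + q.+2.-1) %% q.+2)%N = (y == x - 1).
  by rewrite -val_eqE /= modnDmr (@modn_small 1) // subn1.
have oneE : ((y : nat) == 1 %% q.+2)%N = (y == 1) by rewrite -val_eqE.
have m1E : ((y : nat) == q.+2.-1 %% q.+2)%N = (y == - 1).
  by rewrite -val_eqE /= (@modn_small 1) // subn1.
have x0E : ((x : nat) == 0)%N = (x == 0) by rewrite -val_eqE.
rewrite succE predE oneE m1E x0E.
by do 5![case: (_ == _)] => /=; lra.
Qed.

Lemma reflmx_jumpmx : reflmx *m jumpmx = jumpmx.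
Proof. by apply/matrixP => x y; rewrite reflmx_mulE !mxE oppr_eq0. Qed.

Lemma jumpmx_reflmx : jumpmx *m reflmx = - jumpmx.
Proof.
by apply/matrixP => x y; rewrite mul_reflmxE !mxE eqr_opp eqr_oppLR -mulrN opprB.
Qed.

(** With [J] the jump and [S] the reflection, [J A^k J = J A^k S J = J S A^k J = - J A^k J]. *)
Lemma jumpmx_reflection A k : reflmx * A = A * reflmx ->
  jumpmx * A ^+ k * jumpmx = 0.
Proof.
move=> JA; have JAk : reflmx * A ^+ k = A ^+ k * reflmx by apply: commrX.
have : jumpmx * A ^+ k * jumpmx = - (jumpmx * A ^+ k * jumpmx).
  rewrite -{2}reflmx_jumpmx mulmxE mulrA -(mulrA jumpmx) -JAk mulrA.
  by rewrite -mulmxE jumpmx_reflmx mulmxE !mulNr.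
move: (jumpmx * _ * _) => M /matrixP opp; apply/matrixP => x y; move: (opp x y).
by rewrite !mxE; lra.
Qed.

Lemma reflmx_walkmx : reflmx * walkmx = walkmx * reflmx.
Proof.
rewrite /walkmx mxscaleAl mxscaleAr mulrDl mulrDr -!mulmxE !reflmx_shiftmx.
by rewrite opprK [in LHS]addrC.
Qed.

Lemma walkmx_sqr : walkmx * walkmx = lazymx (1 + 1).
Proof.
rewrite /walkmx mxscaleAl mxscaleAr mulrDl !mulrDr -!mulmxE !shiftmxM.
rewrite subrr addNr shiftmx0 -opprD /lazymx.
by apply/matrixP => x y; rewrite !mxE; lra.
Qed.

Lemma lazymx_walkmx : (1/2) *: (1%:M + walkmx) = lazymx 1.
Proof. by apply/matrixP => x y; rewrite !mxE; lra. Qed.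

(** The walk gives each neighbour of 0 at least 1/2, while the jump is bounded by 1; this is the
    origin of the relative size [2 * eps]. *)
Lemma jumpmx_le x y : `|jumpmx x y| <= 2 * walkmx x y.
Proof.
rewrite !mxE; have [->|_] := eqVneq x 0.
  rewrite !add0r mul1r ler_norml.
  by case: (_ == _); case: (_ == _) => /=; apply/andP; split; lra.
by rewrite mul0r normr0 mulr_ge0 // mulr_ge0 ?addr_ge0 ?ler0n.
Qed.

Lemma sum_eq1 a : \sum_(y : V) (y == a)%:R = 1 :> R.
Proof. by rewrite (bigD1 a) //= eqxx big1 ?addr0 // => y /negPf ->. Qed.

Lemma sum_jumpmx x : \sum_y jumpmx x y = 0.
Proof.
under eq_bigr do rewrite mxE.
by rewrite -mulr_sumr sumrB !sum_eq1 subrr mulr0.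
Qed.

Lemma sum_walkmx x : \sum_y walkmx x y = 1.
Proof.
under eq_bigr do rewrite !mxE.
by rewrite -mulr_sumr big_split /= !sum_eq1; lra.
Qed.

Lemma Qfam_perturb eps A : Qfam eps A ->
  exists2 d, `|d| <= eps & A = walkmx + d *: jumpmx.
Proof. by case=> d [deps ->]; exists d; rewrite ?ler_norml // QdeltaE. Qed.

Lemma Qlazy_perturb eps A : Qlazy eps A ->
  exists2 d, `|d| <= eps & A = lazymx 1 + (d / 2) *: jumpmx.
Proof.
case=> B [/Qfam_perturb[d deps ->] ->]; exists d => //.
rewrite -lazymx_walkmx addrA scalerDr scalerA; congr (_ + _ *: _); lra.
Qed.

Lemma stochastic_Qfam eps A : eps < 1/2 -> Qfam eps A -> stochastic A.
Proof.
move=> eps2 /Qfam_perturb[d deps ->]; split=> [x y|x]; last first.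
  under eq_bigr do rewrite mxE [X in _ + X]mxE.
  by rewrite big_split /= -mulr_sumr sum_walkmx sum_jumpmx mulr0 addr0.
rewrite mxE [X in _ + X]mxE.
have dJ : `|d * jumpmx x y| <= 1/2 * (2 * walkmx x y).
  by rewrite normrM ler_pM ?jumpmx_le // ltW // (le_lt_trans deps).
by move: dJ; rewrite ler_norml => /andP[]; lra.
Qed.

Lemma stochastic_Qlazy eps A : eps < 1/2 -> Qlazy eps A -> stochastic A.
Proof.
move=> eps2 [B [/(stochastic_Qfam eps2)[B0 B1] ->]].
have [I0 I1] := @stochastic1 R q.+2.
split=> [x y|x].
  by rewrite mxE [X in _ * X]mxE mulr_ge0 ?addr_ge0.
under eq_bigr do rewrite mxE [X in _ * X]mxE.
by rewrite -mulr_sumr big_split /= B1 I1; lra.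
Qed.

(** The factor 1/2 comes from powers of the unperturbed kernel, the quotient from passing to it and
    back. *)
Definition harnack_const eps : R := 1/2 * (1 - 2 * eps) / (1 + 2 * eps).

Lemma Kprod_harnack eps A (K : nat -> 'M[R]_q.+2) T :
  0 < eps -> eps < 1/2 -> reflmx * A = A * reflmx ->
  (forall x y z, 1/2 * (A ^+ T) x z <= (A ^+ T) y z) ->
  (forall i, (0 < i)%N -> exists2 s, K i = A + s *: jumpmx &
     forall x y, `|s * jumpmx x y| <= 2 * eps * A x y) ->
  forall x y z, harnack_const eps * Kprod K T x z <= Kprod K T y z.
Proof.
move=> eps0 eps2 JA AT KA x y z.
have KAE i : (0 < i)%N -> exists s, K i - A = s *: jumpmx.
  by move=> /KA[s -> _]; exists s; rewrite addrAC subrr add0r.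
have bounds := @Kprod_perturb_bounds R q.+2 A K (2 * eps) T.
have {}bounds u : (1 - 2 * eps) * (A ^+ T) u z <= Kprod K T u z
                  <= (1 + 2 * eps) * (A ^+ T) u z.
  apply: bounds; [lra|lra| |].
    move=> i j k /KAE[s ->] /KAE[s' ->].
    by rewrite !mxscaleAl mxscaleAr jumpmx_reflection // !scaler0.
  move=> i /KA[s -> sA] v w; rewrite addrAC subrr add0r mxE; exact: sA.
have /andP[_ Kx] := bounds x; have /andP[Ky _] := bounds y.
apply: le_trans Ky; rewrite /harnack_const mulrAC ler_pdivrMr; last lra.
have e1 : 0 <= 1 - 2 * eps by lra.
have := ler_wpM2l e1 Kx; have := AT x y z.
have e2 : 0 <= (1 - 2 * eps) * (1 + 2 * eps) by rewrite mulr_ge0 //; lra.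
by move=> /(ler_wpM2l e2); lra.
Qed.

(** Squaring the simple walk makes it lazy with steps of 2; the inverse [b] of 2 ensures that such
    steps still reach every vertex. *)
Lemma Qfam_harnack eps b (K : nat -> 'M[R]_q.+2) :
  0 < eps -> eps < 1/2 -> b * (1 + 1) = 1 ->
  (forall i, (0 < i)%N -> Qfam eps (K i)) ->
  let T := (64 * q.+2 ^ 2)%N in
  forall x y z, harnack_const eps * Kprod K T x z <= Kprod K T y z.
Proof.
move=> eps0 eps2 b2 FK T x y z.
apply: (@Kprod_harnack eps walkmx) => //; first exact: reflmx_walkmx.
  (* One factor 2 is spent on squaring the walk, another on the even exponent [n + n] with
     [n = 16 * q.+2 ^ 2]. *)
  have -> : T = (2 * (16 * q.+2 ^ 2 + 16 * q.+2 ^ 2))%N by rewrite /T; ring.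
  rewrite exprM expr2 walkmx_sqr => u v w; exact: (lazymxX_harnack w u v b2).
move=> i /FK/Qfam_perturb[d deps ->]; exists d => // u v.
rewrite normrM [2 * eps]mulrC -mulrA ler_pM //; exact: jumpmx_le.
Qed.

Lemma Qlazy_harnack eps (K : nat -> 'M[R]_q.+2) :
  0 < eps -> eps < 1/2 -> (forall i, (0 < i)%N -> Qlazy eps (K i)) ->
  let T := (32 * q.+2 ^ 2)%N in
  forall x y z, harnack_const eps * Kprod K T x z <= Kprod K T y z.
Proof.
move=> eps0 eps2 FK T x y z.
apply: (@Kprod_harnack eps (lazymx 1)) => //.
- rewrite -lazymx_walkmx mxscaleAl mxscaleAr mulrDl mulrDr reflmx_walkmx.
  by rewrite -!mulmxE mulmx1 mul1mx.
- have -> : T = (16 * q.+2 ^ 2 + 16 * q.+2 ^ 2)%N by rewrite /T; ring.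
  by move=> u v w; apply: (@lazymxX_harnack _ _ 1 1); rewrite ?mulr1.
move=> i /FK/Qlazy_perturb[d deps ->]; exists (d / 2) => // u v.
(* The halved [d] is matched by the weight 1/2 of [walkmx] in the lazy kernel, so the relative size
   stays [2 * eps]. *)
have -> : lazymx 1 u v = 1/2 * (1%:M u v + walkmx u v).
  by rewrite -lazymx_walkmx mxE [X in _ * X]mxE.
have := jumpmx_le u v; have : 0 <= 1%:M u v :> R by rewrite mxE ler0n.
have /ger0_norm d2 : 0 <= 2^-1 :> R by rewrite invr_ge0.
rewrite !normrM d2 => I0 J.
have := ler_pM (normr_ge0 d) (normr_ge0 _) deps J.
by have := mulr_ge0 (ltW eps0) I0; lra.
Qed.

End Walk.

(** * From oscillation to relative deviation and merging time *)

Lemma tv_le (R : realType) (p : nat) (mu nu : 'I_p -> R) (eta : R) :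
  0 <= eta -> (forall z, mu z - nu z <= eta * nu z) -> (forall z, 0 <= nu z) ->
  \sum_z nu z = 1 -> tv mu nu <= eta.
Proof.
move=> eta0 munu nu0 nu1; apply: bigmax_le => // A _.
apply: (@le_trans _ _ (\sum_(z in A) eta * nu z)); first exact: ler_sum.
rewrite -[leRHS]mulr1 -nu1 -mulr_sumr ler_wpM2l // [leRHS](bigID (mem A)) /=.
by rewrite lerDl sumr_ge0.
Qed.

Lemma ratio_dev_le (R : realType) (a b eta : R) :
  0 <= eta -> 0 <= a -> 0 <= b -> a - b <= eta * b -> b - a <= eta * b ->
  (ratio_dev a b <= eta%:E)%E.
Proof.
move=> eta0 a0 b0 ab ba; rewrite /ratio_dev; have [b_eq0|bn0] := eqVneq b 0.
  (* A zero denominator forces a zero numerator, where the convention [0/0 = 1] gives deviation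
     0. *)
  have -> : a = 0.
    by apply/eqP; rewrite eq_le a0 andbT; move: ab; rewrite b_eq0; lra.
  by rewrite eqxx lee_fin.
have bp : 0 < b by rewrite lt_neqAle eq_sym bn0.
rewrite lee_fin -[1](divff bn0) -mulrBl normrM [`|b^-1|]gtr0_norm ?invr_gt0 //.
by rewrite ler_pdivrMr // ler_norml; apply/andP; split; lra.
Qed.

(** Since [(1 - c)^k <= exp (- c k)], it suffices that [exp (c k)] exceeds [1 / (c eta)]. Bounding
    [1 / c] by [exp (1 / c)] yields the term [c^-1 ^+ 2] after division by [c]. *)
Lemma contraction_rate_le (R : realType) (c eta L : R) (k : nat) :
  0 < c -> c <= 1 -> 0 < eta -> 1 / eta <= expR L ->
  c^-1 ^+ 2 + L / c <= k%:R -> (1 - c) ^+ k / c <= eta.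
Proof.
move=> c0 c1 eta0 etaL kL.
have ck : c^-1 + L <= c * k%:R.
  rewrite -ler_pdivrMl //; apply: le_trans kL.
  by rewrite mulrDr expr2 [_^-1 * L]mulrC.
have e1 : (1 - c) ^+ k <= expR (- (c * k%:R)).
  rewrite -mulNr expRM_natr lerXn2r ?nnegrE ?subr_ge0 ?expR_ge0 //.
  exact: expR_ge1Dx.
have e2 : c^-1 * (1 / eta) <= expR (c * k%:R).
  apply: (@le_trans _ _ (expR (c^-1 + L))); last by rewrite ler_expR.
  rewrite expRD ler_pM ?invr_ge0 ?divr_ge0 ?(ltW c0) ?(ltW eta0) //.
  by apply: le_trans (expR_ge1Dx _); rewrite lerDr.
rewrite ler_pdivrMr //; apply: le_trans e1 _.
rewrite expRN invf_ple ?posrE ?expR_gt0 ?mulr_gt0 //.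
by apply: le_trans e2; rewrite invfM div1r mulrC.
Qed.

Lemma le_expR_logp (R : realType) (x : R) : 0 < x -> x <= expR (logp x).
Proof.
by move=> x0; rewrite -[leLHS]lnK ?posrE // ler_expR /logp le_max lexx.
Qed.

Lemma merging_of_harnack (R : realType) (p T N : nat) (F : 'M[R]_p -> Prop)
    (C c eta : R) :
  0 < c -> c <= 1 -> 0 < eta -> (0 < T)%N -> T%:R <= C * N%:R ^+ 2 ->
  (forall A, F A -> stochastic A) ->
  (forall K : nat -> 'M[R]_p, (forall i, (0 < i)%N -> F (K i)) ->
     forall x y z, c * Kprod K T x z <= Kprod K T y z) ->
  let bound := C * (2 + c^-1 + c^-1 ^+ 2) * N%:R ^+ 2 * (1 + logp (1 / eta)) in
  (forall K : nat -> 'M[R]_p, (forall i, (0 < i)%N -> F (K i)) ->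
     forall n : nat, bound <= n%:R -> forall x y z : 'I_p,
     (ratio_dev (Kprod K n x z) (Kprod K n y z) <= eta%:E)%E)
  /\ merging_time_le F eta bound.
Proof.
move=> c0 c1 eta0 T0 TC Fs FT bound.
have osc K : (forall i, (0 < i)%N -> F (K i)) -> forall n, bound <= n%:R ->
    forall z, osc_le eta (fun x => Kprod K n x z).
  move=> FK n; rewrite /bound; set L := logp _ => bn z.
  have L0 : 0 <= L by rewrite /L /logp le_max lexx orbT.
  have T0' : 0 < T%:R :> R by rewrite ltr0n.
  have ic0 : 0 <= c^-1 by rewrite invr_ge0 ltW.
  (* The summand 2 pays for rounding in [n %/ T] and for the block giving the initial bound; the
     others supply the count needed by [contraction_rate_le]. *)
  set X := 2 + _ + _ in bn.
  have X2 : 2 <= X by rewrite /X -addrA lerDl addr_ge0 ?exprn_ge0.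
  have Tn : T%:R * (X * (1 + L)) <= n%:R.
    apply: le_trans bn.
    rewrite (_ : C * _ * _ * _ = C * N%:R ^+ 2 * (X * (1 + L))); last by ring.
    by rewrite ler_wpM2r // mulr_ge0 //; lra.
  have n_lt : n%:R < T%:R * ((n %/ T).+1)%:R :> R.
    by rewrite -natrM ltr_nat mulnC -ltn_divLR.
  have kX : X * (1 + L) < (n %/ T).+1%:R.
    by rewrite -(ltr_pM2l T0'); apply: le_lt_trans Tn n_lt.
  have XL : 0 <= (X - 2) * L by rewrite mulr_ge0 // subr_ge0.
  have : (1 <= n %/ T)%N.
    rewrite -ltnS -(ltr_nat R); apply: le_lt_trans kX; nra.
  case E : (n %/ T)%N => [|k] // _.
  have kT : (k.+1 * T <= n)%N by rewrite -E leq_divM.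
  have [h0 hosc] := osc_le_Kprod c0 c1 Fs FT FK z kT.
  split=> // x y w; apply: le_trans (hosc x y w) _.
  rewrite ler_wpM2r //; apply: (@contraction_rate_le _ _ _ L) => //.
    by apply: le_expR_logp; rewrite divr_gt0.
  move: kX; rewrite E -[k.+2%:R]natr1 -[k.+1%:R]natr1 /X.
  by have := mulr_ge0 (exprn_ge0 2 ic0) L0; have := mulr_ge0 ic0 L0; nra.
split=> [K FK n bn x y z|K FK n bn x y].
  have [h0 hosc] := osc K FK n bn z.
  by apply: ratio_dev_le; rewrite ?hosc ?h0 // ltW.
have [K0 K1] : stochastic (Kprod K n).
  by apply: stochastic_Kprod => i /FK /Fs.
apply: tv_le => //; first exact: ltW.
by move=> z; have [_ hosc] := osc K FK n (ltW bn) z; apply: hosc.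
Qed.

(** Twice [(q + 3) / 2] is one more than the modulus. *)
Lemma inv2_odd_ord (q : nat) : odd q ->
  exists b : 'I_q.+2, b * (1 + 1) = 1.
Proof.
move=> q_odd; exists (q.+3./2)%:R; rewrite -[1 + 1]/(2%:R) -natrM.
have -> : (q.+3./2 * 2 = q.+2 + 1)%N.
  by rewrite muln2 addn1 -[RHS]odd_double_half /= negbK q_odd.
by apply/val_inj; rewrite Zp_nat /= modnDl.
Qed.

Theorem theorem3p5 (R : realType) (eps : R) :
  0 < eps -> eps < 1/2 ->
  exists B : R, 0 < B /\
  forall (N : nat) (eta : R), 0 < eta ->
    let bound := B * (N%:R) ^+ 2 * (1 + logp (1 / eta)) in
    ((2 <= N)%N ->
       (forall K : nat -> 'M[R]_(2 * N),
          (forall i, (0 < i)%N -> Qlazy eps (K i)) ->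
          forall n : nat, bound <= n%:R ->
          forall x y z : 'I_(2 * N),
            (ratio_dev (Kprod K n x z) (Kprod K n y z) <= eta%:E)%E)
       /\ merging_time_le (@Qlazy R (2 * N) eps) eta bound)
    /\
    ((1 <= N)%N ->
       (forall K : nat -> 'M[R]_(2 * N + 1),
          (forall i, (0 < i)%N -> Qfam eps (K i)) ->
          forall n : nat, bound <= n%:R ->
          forall x y z : 'I_(2 * N + 1),
            (ratio_dev (Kprod K n x z) (Kprod K n y z) <= eta%:E)%E)
       /\ merging_time_le (@Qfam R (2 * N + 1) eps) eta bound).
Proof.
move=> eps0 eps2; pose c := harnack_const eps.
have c0 : 0 < c by rewrite /c /harnack_const divr_gt0 ?mulr_gt0 //; lra.
have c1 : c <= 1 by rewrite /c /harnack_const ler_pdivrMr; lra.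
have ic0 : 0 < c^-1 by rewrite invr_gt0.
(* The odd case dictates 576: [64 (2 N + 1)^2 <= 64 (3 N)^2] for [N >= 1]. The even case has only
   [32 (2 N)^2]. *)
exists (576 * (2 + c^-1 + c^-1 ^+ 2)); split.
  by rewrite mulr_gt0 // addr_gt0 ?exprn_gt0 // addr_gt0.
move=> N eta eta0 bound; split=> N0.
  have [q qE] : exists q, (2 * N = q.+2)%N.
    by case: N N0 {bound} => [|[|N]] //= _; exists (2 * N + 2)%N; lia.
  have TC : (32 * (2 * N) ^ 2)%:R <= 576 * N%:R ^+ 2 :> R.
    by rewrite natrM natrX natrM; have := sqr_ge0 (N%:R : R); nra.
  rewrite /bound; clear bound; move: TC; rewrite {}qE => TC.
  apply: merging_of_harnack TC _ _ => //.
    by move=> A; apply: stochastic_Qlazy.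
  by move=> K FK; apply: Qlazy_harnack.
have [q q_odd qE] : exists2 q, odd q & (2 * N + 1 = q.+2)%N.
  by exists (2 * N).-1; case: N N0 {bound} => [|N] //= _; lia.
have TC : (64 * (2 * N + 1) ^ 2)%:R <= 576 * N%:R ^+ 2 :> R.
  have N1 : 1 <= N%:R :> R by rewrite ler1n.
  by rewrite natrM natrX natrD natrM; nra.
have [b b2] := inv2_odd_ord q_odd.
rewrite /bound; clear bound; move: TC; rewrite {}qE => TC.
apply: merging_of_harnack TC _ _ => //.
  by move=> A; apply: stochastic_Qfam.
by move=> K FK; apply: (Qfam_harnack eps0 eps2 b2).
Qed.
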